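(* Let $a\ge b\ge 2$ be integers, and let $r_a,r_b\in\{0,1,2\}$ be the remainders of $a$ and $b$ modulo $3$. If the spider $S(a,b,2)$ is $e$-positive, then either $(r_a,r_b)=(0,1)$ or $r_b=0$. *)

(* Defs.v *)
From HB Require Import structures.
From mathcomp Require Import all_boot all_order all_algebra.
From mathcomp Require Import mpoly.
Set Implicit Arguments. Unset Strict Implicit. Unset Printing Implicit Defensive.
Import Order.TTheory GRing.Theory Num.Theory.
Local Open Scope ring_scope.

Definition proper_col (V : finType) (e : rel V) (N : nat) (f : {ffun V -> 'I_N}) : bool :=
  [forall x, forall y, e x y ==> (f x != f y)].

Definition chrom_sym (V : finType) (e : rel V) (N : nat) : {mpoly rat[N]} :=
  \sum_(f : {ffun V -> 'I_N} | proper_col e f) \prod_(v : V) 'X_(f v).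

Definition is_partition (n : nat) (l : seq nat) : bool :=
  [&& sorted geq l, all (fun k => 0 < k)%N l & sumn l == n].

Definition elem_sym (N : nat) (l : seq nat) : {mpoly rat[N]} :=
  \prod_(k <- l) mesym N rat k.

(* e-positivity: X_G is a nonnegative combination of the e_lambda, lambda |- |V|.
   Computed in N = |V| variables (the truncation Lambda^n -> Lambda_N^n is an
   isomorphism for N >= n, so this is the usual notion). *)
Definition e_positive (V : finType) (e : rel V) : Prop :=
  exists s : seq (rat * seq nat),
    all (fun p => (0 <= p.1) && is_partition #|V| p.2) s /\
    chrom_sym e #|V| = \sum_(p <- s) p.1 *: elem_sym #|V| p.2.

(* The spider S(a,b,c): a centre (vertex 0) with three legs (paths) of
   a, b, c vertices (i.e. lengths a, b, c edges); a+b+c+1 vertices total.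
   Leg 1 = vertices 1..a, leg 2 = a+1..a+b, leg 3 = a+b+1..a+b+c. *)
Definition leg_start (a b c v : nat) : bool :=
  [|| (v == 1) && (0 < a), (v == a + 1) && (0 < b) | (v == a + b + 1) && (0 < c)]%N.

Definition spider_adj_nat (a b c u v : nat) : bool :=
  [|| (u == 0)%N && leg_start a b c v
    | (0 < u)%N && (v == u.+1) && ~~ leg_start a b c v].

Definition spider_adj (a b c : nat) : rel 'I_(a + b + c).+1 :=
  fun x y => spider_adj_nat a b c x y || spider_adj_nat a b c y x.
Arguments spider_adj a b c : clear implicits.

(* Main.v *)
Require Import Defs.
From mathcomp Require Import all_boot all_order all_algebra.
From mathcomp Require Import mpoly.
From mathcomp Require Import ring lra zify.
Set Implicit Arguments. Unset Strict Implicit. Unset Printing Implicit Defensive.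
Import Order.TTheory GRing.Theory Num.Theory.

(* Let P_m be the chromatic symmetric function of the path with m vertices. Colouring the centre
   first, the spider S(a,b,2) on n = a + b + 3 vertices has chromatic symmetric function
     P_2 P_{n-2} - P_{b+1} P_{a+2} + P_1 P_{n-1} - P_{b+2} P_{a+1} + P_n,
   and P_m = e_m + sum_{k >= 2} (k - 1) e_k P_{m-k}. Hence the coefficient of a monomial in the
   e_k can be read off after setting e_3 = 1, e_d = 'X and e_k = 0 for the other k >= 1. In each
   excluded class (a mod 3, b mod 3) some coefficient is negative, with q = n %/ 3 that of
     e_3^q for (1,2) and (2,1),   e_3^q e_1 for (2,2),   e_3^q e_2 for (1,1),
     e_3^(q-2) e_4^2 for (0,2). *)

(** * Derivative of a finite product of polynomials *)

Lemma deriv_prod_seq (R : comNzRingType) (I : eqType) (r : seq I) (F : I -> {poly R}) :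
  uniq r ->
  ((\prod_(i <- r) F i)^`() = \sum_(i <- r) (F i)^`() * \prod_(j <- r | j != i) F j)%R.
Proof.
elim: r => [_|i r IH /= /andP[ir /IH{}IH]]; first by rewrite !big_nil derivC.
rewrite !big_cons derivM IH eqxx /=; congr (_ * _ + _)%R.
  rewrite big_seq [RHS]big_seq_cond; apply: eq_bigl => j.
  by case: eqVneq => [->|]; rewrite ?andbT // (negbTE ir).
rewrite mulr_sumr; apply: eq_big_seq => j jr; rewrite big_cons.
by case: eqVneq => [ij|_]; [rewrite ij jr in ir | rewrite mulrCA].
Qed.

Lemma deriv_prod (R : comNzRingType) (I : finType) (F : I -> {poly R}) :
  ((\prod_i F i)^`() = \sum_i (F i)^`() * \prod_(j | j != i) F j)%R.
Proof. exact/deriv_prod_seq/index_enum_uniq. Qed.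

(** * Weighted sums over words without equal neighbours, and their recurrences *)

Section ProperWords.
Local Open Scope ring_scope.
Variables (R : comNzRingType) (I : finType) (x : I -> R).

(** Weight of the proper colourings of a path of [m] vertices hung from a vertex of colour [i];
    [walk m] is the same for a free path, that is, P_m when the weights are the variables. *)
Fixpoint leg (m : nat) (i : I) : R :=
  if m is m'.+1 then \sum_(j | i != j) x j * leg m' j else 1.

Definition walk (m : nat) : R :=
  if m is m'.+1 then \sum_i x i * leg m' i else 1.

#[local] Arguments leg : simpl never.
#[local] Arguments walk : simpl never.

Lemma walkS m : walk m.+1 = \sum_i x i * leg m i.
Proof. by []. Qed.

(** Split the proper words of length [m.+1] by whether their first letter is [i]. *)
Lemma mul_leg m i : x i * leg m i = walk m.+1 - leg m.+1 i.
Proof.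
rewrite walkS (bigD1 i) //= (eq_bigl (fun j => i != j)) ?addrK // => j.
by rewrite eq_sym.
Qed.

Lemma legS m i : leg m.+1 i = walk m.+1 - x i * leg m i.
Proof. by rewrite mul_leg; ring. Qed.

(** Two legs glued at their centre form a path. Moving a vertex from one leg to the other keeps the
    sum: by [legS] both sides are [walk a.+1 * walk b.+1] minus the same sum. *)
Lemma sum_leg2 a b : \sum_i x i * leg a i * leg b i = walk (a + b).+1.
Proof.
elim: a b => [|a IH] b.
  by rewrite add0n; apply: eq_bigr => i _; rewrite mulr1.
rewrite addSnnS -IH.
under eq_bigr do rewrite legS mulrBr mulrBl.
under [RHS]eq_bigr do rewrite legS mulrBr.
rewrite !sumrB; congr (_ - _); last by apply: eq_bigr => i _; ring.
transitivity (walk a.+1 * walk b.+1).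
  by rewrite [walk b.+1]walkS mulr_sumr; apply: eq_bigr => i _; ring.
by rewrite [walk a.+1]walkS mulr_suml; apply: eq_bigr => i _; ring.
Qed.

(** Write [leg 1 i] as [walk 1 - x i] and absorb the factor [x i] into the leg [b] by [mul_leg];
    only two-leg sums remain. *)
Lemma sum_leg3_1 a b :
  \sum_i x i * leg a i * leg b i * leg 1 i =
  walk 1 * walk (a + b).+1 - walk b.+1 * walk a.+1 + walk (a + b).+2.
Proof.
rewrite -(sum_leg2 a b) -addnS -(sum_leg2 a b.+1) [walk a.+1]walkS !mulr_sumr.
rewrite -sumrB -big_split; apply: eq_bigr => i _ /[!legS].
rewrite /(leg 0 i); set u := walk 1; set v := walk b.+1; rewrite /=; ring.
Qed.

(** The same absorption, with [leg 2 i = walk 2 - x i * leg 1 i], reduces to a spider with legs [a],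
    [b.+1] and 1. *)
Lemma sum_leg3_2 a b :
  \sum_i x i * leg a i * leg b i * leg 2 i =
  walk 2 * walk (a + b).+1 - walk b.+1 * walk a.+2 + walk 1 * walk (a + b).+2
    - walk b.+2 * walk a.+1 + walk (a + b).+3.
Proof.
transitivity (walk 2 * \sum_i x i * leg a i * leg b i
  - walk b.+1 * (\sum_i x i * leg a i * leg 1 i)
  + \sum_i x i * leg a i * leg b.+1 i * leg 1 i).
  rewrite !mulr_sumr -sumrB -big_split; apply: eq_bigr => i _.
  rewrite [leg 2 i]legS [leg b.+1 i]legS.
  by set u := walk 2; set v := walk b.+1; set w := leg 1 i; rewrite /=; ring.
by rewrite sum_leg3_1 !sum_leg2 addn1 addnS; ring.
Qed.

Definition esum (k : nat) : R := \sum_(h : {set I} | #|h| == k) \prod_(i in h) x i.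

Let E : {poly R} := \prod_i (1 + x i *: 'X).

Lemma coef_prod_esum k : E`_k = esum k.
Proof.
rewrite /E (eq_bigr (fun i => x i *: 'X + 1)) => [|i _]; last by rewrite addrC.
rewrite bigA_distr coef_sum /esum [RHS]big_mkcond /=; apply: eq_bigr => h _.
rewrite -big_mkcond /=.
have -> : \prod_(i in h) (x i *: 'X) = (\prod_(i in h) x i) *: 'X^#|h| :> {poly R}.
  under eq_bigr do rewrite -mul_polyC.
  by rewrite big_split /= prodr_const -rmorph_prod mul_polyC.
by rewrite coefZ coefXn eq_sym; case: eqP; rewrite ?mulr1 ?mulr0.
Qed.

Let E' i : {poly R} := \prod_(j | j != i) (1 + x j *: 'X).

Lemma E_split i : E = (1 + x i *: 'X) * E' i.
Proof. by rewrite /E (bigD1 i). Qed.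

Lemma deriv_E : E^`() = \sum_i x i *: E' i.
Proof.
rewrite deriv_prod //; apply: eq_bigr => i _.
by rewrite derivD derivZ derivX derivC add0r -mul_polyC mulr1 mul_polyC.
Qed.

(* With [W = sum_m walk m X^m] and [H i = sum_m leg m i X^m], multiply [(1 + x i X) H i = W] by the
   product over [j != i] to get [E H i = E' i W]; then sum over [i] with weights [x i]. *)
Lemma walk_esum m :
  \sum_(k < m.+1) esum k * walk (m - k) *+ k = \sum_(k < m) esum k * walk (m - k).
Proof.
pose W := \poly_(k < m.+1) walk k; pose H i := \poly_(k < m.+1) leg k i.
(* Truncating the series at degree [m] costs an error term of degree [m.+1]. *)
have HW i : (1 + x i *: 'X) * H i = W + (x i * leg m i) *: 'X^(m.+1).
  apply/polyP => k; rewrite mulrDl mul1r -scalerAl !coefD !coefZ coefXM coefXn !coef_poly.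
  case: k => [|k] /=; first by rewrite !mulr0.
  rewrite !ltnS eqSS; case: ltngtP => [km|mk|->]; rewrite ?mulr0 ?addr0 ?mulr1 ?add0r //.
  by rewrite legS subrK.
have sumH : \sum_i x i *: ('X * H i) = W - 1 + walk m.+1 *: 'X^(m.+1).
  apply/polyP => k; rewrite coef_sum coefD coefB coefZ coefXn coef1 coef_poly.
  under eq_bigr do rewrite coefZ coefXM coef_poly.
  case: k => [|k] /=; first by rewrite mulr0 addr0 subrr big1 // => i _; rewrite mulr0.
  rewrite !ltnS eqSS subr0; case: ltngtP => [km|mk|->].
  - by rewrite mulr0 addr0.
  - by rewrite mulr0 addr0 big1 // => i _; rewrite mulr0.
  - by rewrite mulr1 add0r.
(* The identity X E' W = E (W - 1) up to multiples of ['X^(m.+1)], which the coefficient of ['X^m]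
   does not see. *)
have key : 'X * E^`() * W = E * (W - 1)
    + (walk m.+1 *: E - \sum_i (x i * (x i * leg m i)) *: ('X * E' i)) * 'X^(m.+1).
  have -> : E * (W - 1) = E * (\sum_i x i *: ('X * H i)) - walk m.+1 *: E * 'X^(m.+1).
    by rewrite sumH -!mul_polyC; ring.
  rewrite mulrBl addrA subrK deriv_E !mulr_sumr !mulr_suml -sumrB.
  apply: eq_bigr => i _.
  transitivity (x i *: ('X * E' i * ((1 + x i *: 'X) * H i))
    - (x i * (x i * leg m i)) *: ('X * E' i) * 'X^(m.+1)).
    rewrite HW -!mul_polyC !polyCM; ring.
  rewrite (E_split i) -!mul_polyC !polyCM; ring.
have := congr1 (fun p : {poly R} => p`_m) key.
rewrite coefD coefMXn ltnSn addr0 -mulrA coefXM mulrBr mulr1 coefB !coefM.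
have Wk j k : (j <= m)%N -> W`_(j - k) = walk (j - k).
  by move=> jm; rewrite coef_poly ltnS (leq_trans (leq_subr _ _) jm).
rewrite [X in _ = X - _]big_ord_recr /= (Wk m) // subnn mulr1 addrK => e.
rewrite big_ord_recl mulr0n add0r.
transitivity (\sum_(j < m) E`_j * W`_(m - j)); last first.
  by apply: eq_bigr => j _; rewrite coef_prod_esum Wk.
rewrite -e; clear e key sumH HW H; move: W Wk => W; case: m => [|m] Wk /=.
  by rewrite big_ord0.
apply: eq_bigr => j _; rewrite coef_deriv coef_prod_esum Wk //.
by rewrite /bump add1n subSS mulrnAl.
Qed.

(** In [walk_esum] at [m.+1], the term of index 0 on the right is [walk m.+1]. Subtracting the other
    terms lowers each factor k to k - 1, except for k = m + 1, which occurs on the left only and so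
    leaves one extra [esum m.+1]. *)
Lemma walk_rec m :
  walk m.+1 = esum m.+1 + \sum_(k < m.+1) esum k.+1 * walk (m - k) *+ k.
Proof.
have e0 : esum 0 = 1.
  by rewrite -coef_prod_esum -horner_coef0 horner_prod big1 // => i _; rewrite !hornerE.
have := walk_esum m.+1.
rewrite big_ord_recl mulr0n add0r [in RHS]big_ord_recl e0 mul1r subn0 => e.
apply: (addIr (\sum_(i < m) esum i.+1 * walk (m - i))).
rewrite -[LHS]e addrAC (eq_bigr (fun k : 'I_m.+1 =>
  esum k.+1 * walk (m - k) *+ k + esum k.+1 * walk (m - k))); last first.
  by move=> k _; rewrite lift0 subSS mulrS addrC.
rewrite big_split addrC; congr (_ + _).
by rewrite big_ord_recr subnn mulr1 addrC.
Qed.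

End ProperWords.

(** * Path functions as polynomials in the elementary symmetric functions *)

Fixpoint ewalks (R : comNzRingType) (t : nat -> R) (m : nat) : seq R :=
  if m is m'.+1 then
    (t m + \sum_(k < m) t k.+1 * (ewalks t m')`_k *+ k)%R :: ewalks t m'
  else [:: 1%R].

(* The polynomial expressing the chromatic symmetric function of the path with
   [m] vertices in terms of the elementary symmetric functions [t 1, t 2, ..]. *)
Definition ewalk (R : comNzRingType) (t : nat -> R) (m : nat) : R := head 0%R (ewalks t m).

Section Ewalk.
Local Open Scope ring_scope.

(** The list keeps all earlier values, latest first, which makes a recurrence on the whole history
    structurally recursive. *)
Lemma nth_ewalks (R : comNzRingType) (t : nat -> R) m k :
  (k <= m)%N -> (ewalks t m)`_k = ewalk t (m - k).
Proof.
elim: m k => [|m IH] [|k] //; by rewrite ltnS subSS => /IH.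
Qed.

Lemma ewalkS (R : comNzRingType) (t : nat -> R) m :
  ewalk t m.+1 = t m.+1 + \sum_(k < m.+1) t k.+1 * ewalk t (m - k) *+ k.
Proof.
rewrite {1}/ewalk /=; congr (_ + _).
by apply: eq_bigr => k _; rewrite nth_ewalks // -ltnS.
Qed.

Lemma ewalk_unique (R : comNzRingType) (t p : nat -> R) :
  p 0 = 1 ->
  (forall m, p m.+1 = t m.+1 + \sum_(k < m.+1) t k.+1 * p (m - k)%N *+ k) ->
  p =1 ewalk t.
Proof.
move=> p0 pS m; elim/ltn_ind: m => -[|m] IH; first by rewrite p0.
rewrite pS ewalkS; congr (_ + _); apply: eq_bigr => k _.
by rewrite IH // ltnS leq_subr.
Qed.

Lemma rmorph_ewalk (R S : comNzRingType) (f : {rmorphism R -> S}) (t : nat -> R) m :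
  f (ewalk t m) = ewalk (fun k => f (t k)) m.
Proof.
apply: (ewalk_unique (p := fun m => f (ewalk t m))) => [|{}m]; first exact: rmorph1.
rewrite ewalkS rmorphD rmorph_sum; congr (_ + _).
by apply: eq_bigr => k _; rewrite rmorphMn rmorphM.
Qed.

Lemma walk_ewalk (R : comNzRingType) (I : finType) (x : I -> R) : walk x =1 ewalk (esum x).
Proof. by apply: ewalk_unique => // m; rewrite walk_rec. Qed.

End Ewalk.

(** * Sums over all words of a given length *)

Section WordSums.
Local Open Scope ring_scope.
Variables (R : comNzRingType) (I : finType) (x : I -> R).

Fixpoint wsum (m : nat) (F : seq I -> R) : R :=
  if m is m'.+1 then \sum_i wsum m' (fun s => F (i :: s)) else F [::].

Lemma eq_wsum m F G : (forall s, size s = m -> F s = G s) -> wsum m F = wsum m G.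
Proof.
elim: m F G => [|m IH] F G FG /=; first exact: FG.
by apply: eq_bigr => i _; apply: IH => s sm; apply: FG; rewrite /= sm.
Qed.

Lemma wsum_cat m n F : wsum (m + n) F = wsum m (fun s => wsum n (fun s' => F (s ++ s'))).
Proof. by elim: m F => [|m IH] F //=; apply: eq_bigr => i _; rewrite IH. Qed.

Lemma mulr_wsumr c m F : c * wsum m F = wsum m (fun s => c * F s).
Proof.
elim: m F => [|m IH] F //=.
by rewrite mulr_sumr; apply: eq_bigr => i _; rewrite IH.
Qed.

Lemma mulr_wsuml c m F : wsum m F * c = wsum m (fun s => F s * c).
Proof. by rewrite mulrC mulr_wsumr; apply: eq_wsum => s _; rewrite mulrC. Qed.

Lemma sum_ffun_wsum m F : \sum_(f : {ffun 'I_m -> I}) F (codom f) = wsum m F.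
Proof.
elim: m F => [|m IH] F /=.
  rewrite (eq_bigr (fun=> F [::])) => [|f _]; last first.
    by have /size0nil -> : size (codom f) = 0%N by rewrite size_codom card_ord.
  by rewrite sumr_const card_ffun card_ord expn0 mulr1n.
(* A function on ['I_m.+1] is its value at [ord0] together with its shifted restriction. *)
pose h (p : I * {ffun 'I_m -> I}) : {ffun 'I_m.+1 -> I} :=
  [ffun k => if unlift ord0 k is Some k' then p.2 k' else p.1].
rewrite (reindex h) /=; last first.
  exists (fun g => (g ord0, [ffun k => g (lift ord0 k)])) => [[i f]|g] _.
    by congr (_, _); [rewrite ffunE unlift_none | apply/ffunP => k; rewrite !ffunE liftK].
  by apply/ffunP => k; rewrite ffunE; case: unliftP => [j|] -> /=; rewrite ?ffunE.
under [RHS]eq_bigr do rewrite -IH.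
rewrite pair_big; apply: eq_bigr => -[i f] _ /=; congr F.
rewrite !codomE enum_ordSl /= ffunE unlift_none /=; congr (_ :: _).
by rewrite -map_comp; apply: eq_map => k /=; rewrite ffunE liftK.
Qed.

Definition neq_path (i : I) (s : seq I) : bool := path (fun u v => u != v) i s.

Lemma wsum_neq_path m i :
  wsum m (fun s => if neq_path i s then \prod_(c <- s) x c else 0) = leg x m i.
Proof.
elim: m i => [|m IH] i /=; first by rewrite big_nil.
rewrite [RHS]big_mkcond /=; apply: eq_bigr => j _.
case: (i != j) => /=.
  by rewrite -IH mulr_wsumr; apply: eq_wsum => s _; rewrite big_cons; case: ifP; rewrite ?mulr0.
by have := mulr_wsumr 0 m (fun=> 0); rewrite !mul0r => {2}->.
Qed.

End WordSums.

(** * Properness of a spider colouring, leg by leg *)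

Section SpiderWord.
Variables (I : finType) (i0 : I).

(** The leg [s] sits at positions [off + 1], [off + 2], ... of the word [w] of the whole spider. The
    vertex before [off + k + 1] is [off + k], except that the first vertex of a leg is attached to
    the centre, at position 0. *)
Lemma neq_path_nth (w s : seq I) (i : I) (off : nat) :
  nth i0 w 0 = i ->
  (forall k, k < size s -> nth i0 w (off + k).+1 = nth i0 s k) ->
  reflect (forall k, k < size s -> nth i0 w (if k == 0 then 0 else off + k)
             != nth i0 w (off + k).+1)
          (neq_path i s).
Proof.
move=> w0 ws.
have e k : k < size s -> nth i0 w (if k == 0 then 0 else off + k) = nth i0 (i :: s) k.
  by case: k => [|k] //= ks; rewrite addnS ws // ltnW.
apply: (iffP (pathP i0)) => H k ks.
  by rewrite e // ws //; apply: H.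
by rewrite -e // -ws //; apply: H.
Qed.

Lemma spider_word_proper a b c i s1 s2 s3 :
  size s1 = a -> size s2 = b -> size s3 = c ->
  [forall u : 'I_(a + b + c).+1, forall v : 'I_(a + b + c).+1, spider_adj a b c u v ==>
     (nth i0 (i :: s1 ++ s2 ++ s3) u != nth i0 (i :: s1 ++ s2 ++ s3) v)] =
  [&& neq_path i s1, neq_path i s2 & neq_path i s3].
Proof.
move=> z1 z2 z3; set w := i :: _; have w0 : nth i0 w 0 = i by [].
have n1 k : k < size s1 -> nth i0 w (0 + k).+1 = nth i0 s1 k.
  by move=> k1; rewrite /w /= nth_cat k1.
have n2 k : k < size s2 -> nth i0 w (a + k).+1 = nth i0 s2 k.
  by move=> k2; rewrite /w /= nth_cat z1 ltnNge leq_addr /= addKn nth_cat k2.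
have n3 k : k < size s3 -> nth i0 w (a + b + k).+1 = nth i0 s3 k.
  move=> k3; rewrite /w /= nth_cat z1 -addnA ltnNge leq_addr /= addKn nth_cat z2.
  by rewrite ltnNge leq_addr /= addKn.
(* Every edge, directed away from the centre, is the k-th edge of one leg; a leg is given by its
   offset and its length. *)
have adjP u v : u < (a + b + c).+1 -> v < (a + b + c).+1 -> spider_adj_nat a b c u v ->
    exists2 ol, ol \in [:: (0, a); (a, b); (a + b, c)] & exists2 k, k < ol.2 &
      u = (if k == 0 then 0 else ol.1 + k) /\ v = (ol.1 + k).+1.
  rewrite /spider_adj_nat /leg_start => un vn uv.
  have [] : (u = 0 /\ (v = 1 /\ 0 < a \/ v = a.+1 /\ 0 < b \/ v = (a + b).+1 /\ 0 < c)) \/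
      (0 < u /\ v = u.+1 /\ (u < a \/ a < u < a + b \/ a + b < u)) by lia.
    move=> [-> [[-> a0]|[[-> b0]|[-> c0]]]].
    - by exists (0, a); [rewrite !inE eqxx | exists 0].
    - by exists (a, b); [rewrite !inE eqxx orbT | exists 0; rewrite //= addn0].
    - by exists (a + b, c); [rewrite !inE eqxx !orbT | exists 0; rewrite //= addn0].
  move=> [u0 [-> [ua|[/andP[au ub]|bu]]]].
  - by exists (0, a); [rewrite !inE eqxx | exists u; rewrite // gtn_eqF].
  - exists (a, b); first by rewrite !inE eqxx orbT.
    by exists (u - a); rewrite /= ?subn_eq0 1?leqNgt ?au /=; lia.
  - exists (a + b, c); first by rewrite !inE eqxx !orbT.
    by exists (u - (a + b)); rewrite /= ?subn_eq0 1?leqNgt ?bu /=; lia.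
apply/forallP/and3P => [H|[/(neq_path_nth w0 n1) P1 /(neq_path_nth w0 n2) P2
    /(neq_path_nth w0 n3) P3]]; last first.
  have P u v : u < (a + b + c).+1 -> v < (a + b + c).+1 -> spider_adj_nat a b c u v ->
    nth i0 w u != nth i0 w v.
    move=> un vn /adjP[] // -[o l]; rewrite !inE => /or3P[] /eqP[-> ->] [k /= kl [-> ->]].
    - by apply: P1; rewrite z1.
    - by apply: P2; rewrite z2.
    - by apply: P3; rewrite z3.
  by move=> u; apply/forallP => v; apply/implyP => /orP[] /P; rewrite 1?eq_sym; apply.
have {}H u v : u < (a + b + c).+1 -> v < (a + b + c).+1 -> spider_adj_nat a b c u v ->
    nth i0 w u != nth i0 w v.
  move=> un vn uv; have /forallP/(_ (Ordinal vn))/implyP := H (Ordinal un).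
  by apply; rewrite /spider_adj uv.
split.
- apply/(neq_path_nth w0 n1) => -[|k] kl; apply: H; rewrite /spider_adj_nat /leg_start /=; lia.
- apply/(neq_path_nth w0 n2) => -[|k] kl; apply: H; rewrite /spider_adj_nat /leg_start /=; lia.
- apply/(neq_path_nth w0 n3) => -[|k] kl; apply: H; rewrite /spider_adj_nat /leg_start /=; lia.
Qed.

End SpiderWord.

(** * The chromatic symmetric function of a spider *)

Section ChromSpider.
Local Open Scope ring_scope.

Lemma chrom_sym_spider a b c N : (0 < N)%N ->
  chrom_sym (spider_adj a b c) N =
  \sum_i 'X_i * leg (fun j : 'I_N => 'X_j) a i * leg (fun j => 'X_j) b i * leg (fun j => 'X_j) c i
  :> {mpoly rat[N]}.
Proof.
(* With a successor in place of [N], [ord0] can serve as the default letter of [nth]. *)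
case: N => // N _; set x := fun j : 'I_N.+1 => _.
pose G (s : seq 'I_N.+1) : {mpoly rat[N.+1]} :=
  if [forall u : 'I_(a + b + c).+1, forall v : 'I_(a + b + c).+1, spider_adj a b c u v ==>
     (nth ord0 s u != nth ord0 s v)] then \prod_(j <- s) x j else 0.
transitivity (\sum_(f : {ffun 'I_(a + b + c).+1 -> 'I_N.+1}) G (codom f)).
  rewrite /chrom_sym big_mkcond; apply: eq_bigr => f _; rewrite /G.
  have fE (u : 'I_(a + b + c).+1) : nth ord0 (codom f) u = f u.
    by rewrite codomE (nth_map u) ?size_enum_ord // nth_ord_enum.
  rewrite /codom /image_mem big_map big_enum /proper_col.
  by under eq_forallb => u do under eq_forallb => v do rewrite -!fE.
rewrite sum_ffun_wsum /=; apply: eq_bigr => i _.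
rewrite -!(wsum_neq_path x) -!mulrA mulr_wsuml mulr_wsumr -addnA wsum_cat.
apply: eq_wsum => s1 z1; rewrite wsum_cat mulr_wsuml !mulr_wsumr.
apply: eq_wsum => s2 z2; rewrite !mulr_wsumr; apply: eq_wsum => s3 z3.
rewrite /G spider_word_proper // big_cons !big_cat.
by do 3!case: neq_path; rewrite /= ?mul0r ?mulr0.
Qed.

End ChromSpider.

(** * Path functions after setting all but two of the e_k to zero *)

Section Specialisation.
Local Open Scope ring_scope.

(** The term of e_k has factor k - 1, so e_1 drops out and e_2, e_3, e_4 get 1, 2, 3. *)
Lemma ewalk_le4 (R : comNzRingType) (t : nat -> R) m :
  (forall k, (4 < k)%N -> t k = 0) ->
  ewalk t m.+4 = t m.+4 + t 2 * ewalk t m.+2 + t 3 * ewalk t m.+1 *+ 2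
                 + t 4 * ewalk t m *+ 3.
Proof.
move=> t0; rewrite ewalkS -!addrA; congr (_ + _).
rewrite !big_ord_recl big1 => [|k _]; last by rewrite t0 ?mul0r ?mul0rn.
by rewrite addr0 mulr0n add0r mulr1n /= /bump /= !subSS !subn0 !addrA.
Qed.

Lemma ewalk_small (R : comNzRingType) (t : nat -> R) :
  [/\ ewalk t 0 = 1, ewalk t 1 = t 1, ewalk t 2 = t 2 *+ 2 &
      ewalk t 3 = t 3 *+ 3 + t 2 * t 1].
Proof.
have e0 : ewalk t 0 = 1 by [].
have e1 : ewalk t 1 = t 1 by rewrite ewalkS big_ord1 mulr0n addr0.
have e2 : ewalk t 2 = t 2 *+ 2.
  by rewrite ewalkS !big_ord_recl big_ord0 /= /bump /= !subSS !subn0 e0; ring.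
split=> //; rewrite ewalkS !big_ord_recl big_ord0 /= /bump /= !subSS !subn0 e0 e1; ring.
Qed.

(** Setting e_3 = 1 loses nothing for d = 1, 2, 4: in degree n the coefficient of ['X^i] is that of
    e_3^q e_d^i with 3q + di = n. *)
Definition spec (d k : nat) : {poly rat} :=
  if k == 3 then 1 else if k == d then 'X else 0.

Lemma spec_gt4 d k : (d <= 4)%N -> (4 < k)%N -> spec d k = 0.
Proof. by rewrite /spec => d4 k4; do !case: eqP => //; lia. Qed.

Definition specwalk d m : {poly rat} := ewalk (spec d) m.

Lemma spec1_ewalk k :
  [/\ specwalk 1 (3 * k).+1 = 2 ^+ k *: 'X, specwalk 1 (3 * k).+2 = 0
    & specwalk 1 (3 * k).+3 = (3 * 2 ^+ k)%:P ].
Proof.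
have [q0 q1 q2 q3] := ewalk_small (spec 1).
have rec m : specwalk 1 m.+4 = (specwalk 1 m.+1) *+ 2.
  by rewrite /specwalk (ewalk_le4 m (@spec_gt4 1 ^~ isT)) /spec /=; ring.
elim: k => [|k [IH1 IH2 IH3]].
  rewrite muln0 expr0 scale1r mulr1 /specwalk q1 q2 q3 /spec /= mul0rn mul0r addr0; split=> //.
  by rewrite -[3 in RHS]/(3%:R) polyC_natr.
rewrite mulnS !addSn add0n !rec IH1 IH2 IH3 mul0rn !exprS.
split=> //; first by rewrite scalerMnl; congr (_ *: _); ring.
by rewrite -polyCMn; apply: (congr1 polyC); ring.
Qed.

(** In degree m only the ['X^i] with 2i = m modulo 3 occur, whence the zeros. The factor 2 on the
    left avoids a division. *)
Lemma spec2_ewalk k :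
  [/\ (specwalk 2 (3 * k).+1)`_0 = 0 /\ (specwalk 2 (3 * k).+1)`_1 = 0,
      (specwalk 2 (3 * k).+2)`_0 = 0 /\ 2 * (specwalk 2 (3 * k).+2)`_1 = 2 ^+ k * (3 * k%:R + 4)
    & (specwalk 2 (3 * k).+3)`_0 = 3 * 2 ^+ k /\ (specwalk 2 (3 * k).+3)`_1 = 0].
Proof.
have [_ q1 q2] := ewalk_small (spec 2); rewrite [spec 2 1]/= mulr0 addr0 => q3.
have rec m : specwalk 2 m.+4 = 'X * specwalk 2 m.+2 + specwalk 2 m.+1 *+ 2.
  by rewrite /specwalk (ewalk_le4 m (@spec_gt4 2 ^~ isT)) /spec /=; ring.
have rec0 m : (specwalk 2 m.+4)`_0 = 2 * (specwalk 2 m.+1)`_0.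
  by rewrite rec coefD coefMn coefXM /=; ring.
have rec1 m : (specwalk 2 m.+4)`_1 = (specwalk 2 m.+2)`_0 + 2 * (specwalk 2 m.+1)`_1.
  by rewrite rec coefD coefMn coefXM /=; ring.
elim: k => [|k [[a0 a1] [b0 b1] [c0 c1]]].
  rewrite muln0 /specwalk q1 q2 q3 /spec /= !coefMn !coefX !coef0 !coef1 /=.
  by split; split; ring.
rewrite mulnS !addSn add0n !rec0 !rec1 !rec0 a0 a1 b0 c0 c1 exprS -natr1.
split; split; [ring | ring | ring | | ring | ring].
by rewrite mulrDr mulrCA [in X in _ + 2 * X]b1; ring.
Qed.

(** Here ['X^i] occurs in degree m only if i = m modulo 3. The factors 2 and 8 clear the
    denominators. *)
Lemma spec4_ewalk k :
  [/\ (specwalk 4 (3 * k).+2)`_0 = 0 /\ (specwalk 4 (3 * k).+2)`_1 = 0,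
      [/\ (specwalk 4 (3 * k).+3)`_0 = 3 * 2 ^+ k, (specwalk 4 (3 * k).+3)`_1 = 0
        & (specwalk 4 (3 * k).+3)`_2 = 0],
      (specwalk 4 (3 * k).+4)`_0 = 0 /\ 2 * (specwalk 4 (3 * k).+4)`_1 = 2 ^+ k * (9 * k%:R + 8)
    & [/\ (specwalk 4 (3 * k).+4.+1)`_0 = 0, (specwalk 4 (3 * k).+4.+1)`_1 = 0 &
       8 * (specwalk 4 (3 * k).+4.+1)`_2 = 3 * 2 ^+ k * k%:R * (9 * k%:R + 7)]].
Proof.
have [q0 q1 q2] := ewalk_small (spec 4); rewrite [spec 4 1]/= mulr0 addr0 => q3.
have rec m : specwalk 4 m.+4 = (if m == 0%N then 'X else 0) + specwalk 4 m.+1 *+ 2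
    + 'X * specwalk 4 m *+ 3.
  by rewrite /specwalk (ewalk_le4 m (@spec_gt4 4 ^~ isT)) /spec /=; case: m => [|m] /=; ring.
have rec0 m : (specwalk 4 m.+4)`_0 = 2 * (specwalk 4 m.+1)`_0.
  by rewrite rec coefD coefMn coefD coefMn coefXM; case: m => [|m] /=; rewrite ?coefX ?coef0 /=; ring.
have rec1 m : (specwalk 4 m.+4.+1)`_1 = 2 * (specwalk 4 m.+2)`_1 + 3 * (specwalk 4 m.+1)`_0.
  by rewrite rec coefD coefMn coefD coefMn coefXM coef0 /=; ring.
have rec2 m : (specwalk 4 m.+4.+1)`_2 = 2 * (specwalk 4 m.+2)`_2 + 3 * (specwalk 4 m.+1)`_1.
  by rewrite rec coefD coefMn coefD coefMn coefXM coef0 /=; ring.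
elim: k => [|k [[a0 a1] [b0 b1 b2] [c0 c1] [d0 d1 d2]]].
  rewrite muln0 !rec0 rec1 rec2 rec coefD coefMn coefD coefMn coefXM.
  rewrite /specwalk q0 q1 q2 q3 /spec /= !coefMn !coefX !coef0 !coef1 /=.
  by do 2?split; ring.
rewrite mulnS !addSn add0n d0 d1 exprS -natr1.
rewrite (rec0 (3 * k).+2) (rec1 (3 * k).+1) (rec2 (3 * k).+1) a0 a1 b0 b1 b2.
rewrite (rec0 (3 * k).+3) (rec1 (3 * k).+2) c0 b0.
rewrite (rec0 (3 * k).+4) (rec1 (3 * k).+3) (rec2 (3 * k).+3) c0 d0 d1 !mulr0 !addr0.
split; first by split.
- by split; [ring | |].
- split=> //; by rewrite mulrDr c1; ring.
(* This is 8 times the recurrence [rec2], arranged so that [d2] and [c1] apply. *)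
- split=> //; transitivity (2 * (8 * (specwalk 4 (3 * k).+4.+1)`_2)
    + 12 * (2 * (specwalk 4 (3 * k).+4)`_1)).
    by ring.
  by rewrite d2 c1; ring.
Qed.

End Specialisation.

(** * A negative coefficient in each excluded residue class *)

Section Negative.
Local Open Scope ring_scope.


Definition espider2 (R : comNzRingType) (t : nat -> R) (a b : nat) : R :=
  ewalk t 2 * ewalk t (a + b).+1 - ewalk t b.+1 * ewalk t a.+2
  + ewalk t 1 * ewalk t (a + b).+2 - ewalk t b.+2 * ewalk t a.+1
  + ewalk t (a + b).+3.

Lemma coef_espider2 d a b k : (espider2 (spec d) a b)`_k =
  (specwalk d 2 * specwalk d (a + b).+1)`_k - (specwalk d b.+1 * specwalk d a.+2)`_k
  + (specwalk d 1 * specwalk d (a + b).+2)`_k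
  - (specwalk d b.+2 * specwalk d a.+1)`_k + (specwalk d (a + b).+3)`_k.
Proof. by rewrite /espider2 !(coefD, coefN). Qed.

Lemma specwalk1 d : specwalk d 1 = if d == 1%N then 'X else 0.
Proof. by have [_ e _ _] := ewalk_small (spec d); rewrite /specwalk e /spec /= eq_sym. Qed.

Lemma specwalk2 d : specwalk d 2 = if d == 2 then 'X *+ 2 else 0.
Proof.
have [_ _ e _] := ewalk_small (spec d); rewrite /specwalk e /spec /= eq_sym.
by case: (d == 2); rewrite ?mul0rn.
Qed.

Lemma coefM1 (R : comNzRingType) (p r : {poly R}) : (p * r)`_1 = p`_0 * r`_1 + p`_1 * r`_0.
Proof. by rewrite coefM !big_ord_recl big_ord0 addr0. Qed.

Lemma coefM2 (R : comNzRingType) (p r : {poly R}) :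
  (p * r)`_2 = p`_0 * r`_2 + p`_1 * r`_1 + p`_2 * r`_0.
Proof. by rewrite coefM !big_ord_recl big_ord0 addr0 addrA. Qed.

(** Only P_{b+1} P_{a+2} and P_n contribute, giving (6 - 9) 2^(s+t). For (2,1) the surviving product
    is P_{b+2} P_{a+1}, with the same value. *)
Lemma espider2_12_neg s t : (espider2 (spec 1) (3 * s).+1 (3 * t).+2)`_0 < 0.
Proof.
rewrite coef_espider2 !specwalk1 !specwalk2 /=.
have -> : ((3 * s).+1 + (3 * t).+2 = 3 * (s + t).+1)%N by lia.
have -> : ((3 * t).+4 = (3 * t.+1).+1)%N by lia.
have [_ s2 s3] := spec1_ewalk s; have [_ _ t3] := spec1_ewalk t.
have [_ st2 st3] := spec1_ewalk (s + t).+1.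
rewrite s2 s3 t3 st2 st3 mul0r !mulr0 coefCM !coefC /=.
have : (0 : rat) < 2 ^+ s * 2 ^+ t by rewrite mulr_gt0 // exprn_gt0.
by rewrite exprS exprD; lra.
Qed.

Lemma espider2_21_neg s t : (espider2 (spec 1) (3 * s).+2 (3 * t).+1)`_0 < 0.
Proof.
rewrite coef_espider2 !specwalk1 !specwalk2 /=.
have -> : ((3 * s).+2 + (3 * t).+1 = 3 * (s + t).+1)%N by lia.
have [_ s2 s3] := spec1_ewalk s; have [_ t2 t3] := spec1_ewalk t.
have [_ st2 st3] := spec1_ewalk (s + t).+1.
rewrite s3 t2 t3 st2 st3 !mul0r !mulr0 coefCM !coefC /=.
have : (0 : rat) < 2 ^+ s * 2 ^+ t by rewrite mulr_gt0 // exprn_gt0.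
by rewrite exprS exprD; lra.
Qed.

(** The four nonzero terms give (- 6 + 6 - 6 + 4) 2^(s+t). *)
Lemma espider2_22_neg s t : (espider2 (spec 1) (3 * s).+2 (3 * t).+2)`_1 < 0.
Proof.
rewrite coef_espider2 !specwalk1 !specwalk2 /=.
have -> : ((3 * s).+2 + (3 * t).+2 = (3 * (s + t).+1).+1)%N by lia.
have -> : ((3 * (s + t).+1).+4 = (3 * (s + t).+2).+1)%N by lia.
have -> : ((3 * s).+4 = (3 * s.+1).+1)%N by lia.
have -> : ((3 * t).+4 = (3 * t.+1).+1)%N by lia.
have [_ _ s3] := spec1_ewalk s; have [_ _ t3] := spec1_ewalk t.
have [s1 _ _] := spec1_ewalk s.+1; have [t1 _ _] := spec1_ewalk t.+1.
have [_ _ st3] := spec1_ewalk (s + t).+1; have [st1 _ _] := spec1_ewalk (s + t).+2.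
rewrite s3 t3 s1 t1 st1 st3 mul0r coefCM coefXM coefMC !coefZ !coefX coefC /=.
have : (0 : rat) < 2 ^+ s * 2 ^+ t by rewrite mulr_gt0 // exprn_gt0.
by rewrite !exprS exprD coefC /=; lra.
Qed.

(** The coefficient is - 2^(s+t) (3(s+t) - 2) / 2, negative as soon as s + t > 0. *)
Lemma espider2_11_neg s t : (0 < s)%N -> (espider2 (spec 2) (3 * s).+1 (3 * t).+1)`_1 < 0.
Proof.
move=> s0; rewrite coef_espider2 !specwalk1 !specwalk2 /=.
have -> : ((3 * s).+1 + (3 * t).+1 = (3 * (s + t)).+2)%N by lia.
have -> : ((3 * (s + t)).+4.+1 = (3 * (s + t).+1).+2)%N by lia.
have [_ [s20 s21] [s30 s31]] := spec2_ewalk s.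
have [_ [t20 t21] [t30 t31]] := spec2_ewalk t.
have [_ _ [st30 st31]] := spec2_ewalk (s + t).
have [_ [_ st21] _] := spec2_ewalk (s + t).+1.
rewrite mul0r !coefM1 s20 s30 s31 t20 t30 t31 st30 st31 coef0 coefMn coefX /=.
have P : (0 : rat) < 2 ^+ s * 2 ^+ t by rewrite mulr_gt0 // exprn_gt0.
have s1 : (1 : rat) <= s%:R by rewrite ler1n.
have t1 : (0 : rat) <= t%:R by rewrite ler0n.
have K : (0 : rat) < 2 ^+ s * 2 ^+ t * (3 * (s%:R + t%:R) - 2).
  by rewrite mulr_gt0 // subr_gt0; lra.
have es : (specwalk 2 (3 * s).+2)`_1 = 2 ^+ s * (3 * s%:R + 4) / 2 by lra.
have et : (specwalk 2 (3 * t).+2)`_1 = 2 ^+ t * (3 * t%:R + 4) / 2 by lra.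
rewrite -[(s + t).+1%:R]natr1 natrD exprS exprD in st21.
have est : (specwalk 2 (3 * (s + t).+1).+2)`_1 = 2 ^+ s * 2 ^+ t * (3 * (s%:R + t%:R + 1) + 4) by lra.
by rewrite es et est exprD coefMn coefX /=; lra.
Qed.

(** Eight times the coefficient is - 2^(u+t) (27u^2 + 54t(u-t) + 6(u-t) + 51u + 32); [K1] to [K4]
    and [P] give the signs of these terms. *)
Lemma espider2_02_neg u t : (t <= u)%N -> (espider2 (spec 4) (3 * u.+1) (3 * t).+2)`_2 < 0.
Proof.
move=> tu; rewrite coef_espider2 !specwalk1 !specwalk2 /=.
have -> : (3 * u.+1 + (3 * t).+2 = (3 * (u + t).+1).+2)%N by lia.
have -> : ((3 * u.+1) = (3 * u).+3)%N by lia.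
have [_ _ [u40 u41] [u50 u51 u52]] := spec4_ewalk u.
have [_ [t30 t31 t32] [t40 t41] _] := spec4_ewalk t.
have [_ _ _ [_ _ st]] := spec4_ewalk (u + t).+1.
rewrite !mul0r !coefM2 u40 u50 u51 t30 t31 t32 t40 !coef0.
have P : (0 : rat) < 2 ^+ u * 2 ^+ t by rewrite mulr_gt0 // exprn_gt0.
have t1 : (0 : rat) <= t%:R by rewrite ler0n.
have tu' : (t%:R : rat) <= u%:R by rewrite ler_nat.
have u1 : (0 : rat) <= u%:R by rewrite ler0n.
have ut : (0 : rat) <= u%:R - t%:R by rewrite subr_ge0.
have K1 := mulr_ge0 (ltW P) (mulr_ge0 u1 u1).
have K2 := mulr_ge0 (ltW P) (mulr_ge0 t1 ut).
have K3 := mulr_ge0 (ltW P) ut.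
have K4 := mulr_ge0 (ltW P) u1.
have eu : (specwalk 4 (3 * u).+4)`_1 = 2 ^+ u * (9 * u%:R + 8) / 2 by lra.
have et : (specwalk 4 (3 * t).+4)`_1 = 2 ^+ t * (9 * t%:R + 8) / 2 by lra.
have eu2 : (specwalk 4 (3 * u).+4.+1)`_2 = 3 * 2 ^+ u * u%:R * (9 * u%:R + 7) / 8 by lra.
rewrite -[(u + t).+1%:R]natr1 natrD exprS exprD in st.
have est : (specwalk 4 (3 * (u + t).+1).+4.+1)`_2 =
    3 * (2 ^+ u * 2 ^+ t) * (u%:R + t%:R + 1) * (9 * (u%:R + t%:R + 1) + 7) / 4 by lra.
by rewrite eu et eu2 est; lra.
Qed.

End Negative.

(** * From e-positivity to nonnegative specialised coefficients *)

Section Final.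
Local Open Scope ring_scope.

Lemma eq_ewalk (R : comNzRingType) (t t' : nat -> R) :
  (forall k, t k.+1 = t' k.+1) -> ewalk t =1 ewalk t'.
Proof.
move=> tt'; apply: ewalk_unique => // m; rewrite ewalkS tt'; congr (_ + _).
by apply: eq_bigr => k _; rewrite tt'.
Qed.

Lemma rmorph_espider2 (R S : comNzRingType) (f : {rmorphism R -> S}) (t : nat -> R) (t' : nat -> S)
  a b :
  (forall k, f (t k.+1) = t' k.+1) -> f (espider2 t a b) = espider2 t' a b.
Proof.
move=> /(@eq_ewalk S (fun k => f (t k)) t') tt'; rewrite /espider2 -!tt' -!rmorph_ewalk.
by rewrite rmorphD rmorphB rmorphD rmorphB !rmorphM.
Qed.

Lemma chrom_sym_spider2 a b N : (0 < N)%N ->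
  chrom_sym (spider_adj a b 2) N = espider2 (mesym N rat) a b.
Proof.
move=> N0; rewrite chrom_sym_spider // sum_leg3_2 /espider2.
by rewrite !walk_ewalk.
Qed.

(** By algebraic independence of the elementary symmetric polynomials, the e-expansion lifts to an
    identity between polynomials in free variables, to which [spec d] can be applied. Each e_lambda
    then becomes a product of factors 0, 1 or ['X]. *)
Lemma e_positive_coef_ge0 a b d i : (d <= 4)%N -> (2 <= a + b)%N ->
  e_positive (spider_adj a b 2) -> 0 <= (espider2 (spec d) a b)`_i.
Proof.
move=> d4 ab []; rewrite card_ord => s [/allP sP].
set N := (a + b + 2).+1 in sP *; rewrite chrom_sym_spider2 // => X.
have N4 : (4 < N)%N by rewrite /N; lia.
(* The variable of index [j] stands for e_{j+1}; beyond [N] both [T] and [mesym] vanish, and so does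
   [spec d] because [N > 4]. *)
pose T k : {mpoly rat[N]} := if k is j.+1 then if insub j is Some i then 'X_i else 0 else 0.
pose S := [tuple mesym N rat i.+1 | i < N].
have TS k : T k.+1 \mPo S = mesym N rat k.+1.
  rewrite /T; case: insubP => [j _ <-|]; last by rewrite -leqNgt => Nk; rewrite comp_mpoly0 mesym_geqnE.
  by rewrite comp_mpolyXU -tnth_nth tnth_mktuple.
pose phi : {mpoly rat[N]} -> {poly rat} := mmap polyC (fun j : 'I_N => spec d j.+1).
have phiT k : phi (T k.+1) = spec d k.+1.
  rewrite /T; case: insubP => [j _ <-|]; first by rewrite /phi mmapX mmap1U.
  by rewrite -leqNgt => Nk; rewrite /phi mmap0 spec_gt4 //; lia.
have /msym_fundamental_un e : espider2 T a b \mPo S =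
    (\sum_(p <- s) p.1 *: \prod_(k <- p.2) T k) \mPo S.
  rewrite (rmorph_espider2 _ _ TS) X rmorph_sum /=; apply: eq_big_seq => p /sP /andP[_].
  rewrite comp_mpolyZ rmorph_prod => /and3P[_ /allP p0 _]; congr (_ *: _).
  by apply: eq_big_seq => -[/p0|k _] //; apply/esym/TS.
rewrite -(rmorph_espider2 _ _ phiT) e rmorph_sum coef_sum big_seq.
apply: sumr_ge0 => p /sP /andP[p1 /and3P[_ /allP p0 _]].
rewrite /= mmapZ coefCM mulr_ge0 // -/phi.
rewrite /phi rmorph_prod big_seq.
elim/big_ind: _ i => [i|f g f0 g0 i|[/p0|k _ i] //].
- by rewrite coef1.
- by rewrite coefM sumr_ge0 // => j _; rewrite mulr_ge0.
by rewrite /= -/phi phiT /spec; do 2?case: ifP => _; rewrite ?coef1 ?coefX ?coef0.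
Qed.

End Final.

Theorem theorem4p1 (a b : nat) :
  (2 <= b)%N -> (b <= a)%N ->
  e_positive (spider_adj a b 2) ->
  ((a %% 3 = 0)%N /\ (b %% 3 = 1)%N) \/ (b %% 3 = 0)%N.
Proof.
move=> b2 ab epos.
have no d i : d <= 4 -> ~ ((espider2 (spec d) a b)`_i < 0)%R.
  move=> d4; rewrite ltNge; apply/negP; rewrite negbK; apply: e_positive_coef_ge0 => //; lia.
have ea : a = (3 * (a %/ 3) + a %% 3)%N by lia.
have eb : b = (3 * (b %/ 3) + b %% 3)%N by lia.
move: (a %/ 3) (b %/ 3) (a %% 3) (b %% 3) ea eb
  (ltn_pmod a (isT : 0 < 3)) (ltn_pmod b (isT : 0 < 3)).
move=> s t ra rb ea eb.
case: ra rb ea eb => [|[|[|//]]] [|[|[|//]]] ea eb _ _; try tauto;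
  exfalso; move: no; rewrite ea eb ?addn0 ?addn1 ?addn2 => no.
(* Class (0,2): [a] is positive, so a = 3(u + 1), and b <= a gives t <= u. *)
- case: s ea no => [|u] ea; first lia.
  by move/(_ 4 2 isT); apply; apply: espider2_02_neg; lia.
(* Class (1,1): a >= 2 excludes s = 0. *)
- by apply: (no 2 1 isT); apply: espider2_11_neg; lia.
- exact/(no 1 0 isT)/espider2_12_neg.
- exact/(no 1 0 isT)/espider2_21_neg.
- exact/(no 1 1 isT)/espider2_22_neg.
Qed.
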